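(* The set of Liouville numbers $$L=\left\{ x\in\mathbb{R}\setminus\mathbb{Q} : \forall n\in \mathbb{N} \ \exists p\in\mathbb{Z},\, q\in \mathbb{N},\ q\geq 2,\textrm{ such that } \left| x-\frac{p}{q} \right| <\frac{1}{q^n} \right\}$$ is immeasurable; that is, for every translation invariant Borel measure $\mu$ on $\mathbb{R}$, either $\mu(L)=0$ or $L$ is not $\sigma$-finite with respect to $\mu$.
   Context: A Borel measure on $\mathbb{R}$ is a (countably additive, $[0,\infty]$-valued) measure $\mu$ defined on a $\sigma$-algebra $\mathcal{S}$ of subsets of $\mathbb{R}$ containing all Borel sets ($\mathcal S$ may be larger than the Borel $\sigma$-algebra, and $\mu$ is not assumed to be $\sigma$-finite on $\mathbb{R}$). It is translation invariant if $S+t\in\mathcal{S}$ and $\mu(S+t)=\mu(S)$ for all $S\in\mathcal{S}$, $t\in\mathbb{R}$. A Borel set $B$ is $\sigma$-finite for $\mu$ if it is a countable union of sets in $\mathcal{S}$ of finite $\mu$-measure. A nonempty Borel set $B\subset\mathbb{R}$ is called immeasurable if for every translation invariant Borel measure $\mu$ on $\mathbb{R}$, either $\mu(B)=0$ or $B$ is not $\sigma$-finite for $\mu$. *)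

(* Defs.v *)
From HB Require Import structures.
From mathcomp Require Import all_boot all_order all_algebra.
From mathcomp Require Import all_classical all_reals all_analysis.

Set Implicit Arguments.
Unset Strict Implicit.
Unset Printing Implicit Defensive.

Import Order.TTheory GRing.Theory Num.Theory.
Import numFieldNormedType.Exports.

Local Open Scope classical_set_scope.
Local Open Scope ring_scope.

Definition borel (R : realType) : set (set R) := <<s [set U : set R | open U] >>.

Definition translate (R : realType) (A : set R) (t : R) : set R :=
  [set x + t | x in A].

(* Measures on a sigma-algebra S of subsets of T: [g_sigma_algebraType S] is T
   with measurable sets [<<s S>>], which are exactly the members of S when S is
   a sigma-algebra (measurable_g_measurableTypeE).  This definition and the next
   are for an abstract T because on a realType the library also has the canonical
   Borel structure, which inference may select instead of the one given by S. *)
Definition measure_on (T : pointedType) (R : realType) (S : set (set T)) :=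
  {measure set (g_sigma_algebraType S) -> \bar R}.

Definition sigma_finite_for (T : pointedType) (R : realType) (S : set (set T))
    (mu : measure_on R S) (B : set T) : Prop :=
  @sigma_finite S.-sigma (g_sigma_algebraType S) R B mu.

Definition translation_invariant (R : realType) (S : set (set R))
    (mu : measure_on R S) : Prop :=
  forall (A : set R) (t : R), S A ->
    S (translate A t) /\ mu (translate A t) = mu A.

Definition immeasurable (R : realType) (B : set R) : Prop :=
  [/\ B !=set0,
      borel B &
      forall (S : set (set R)) (mu : measure_on R S),
        sigma_algebra setT S ->
        @borel R `<=` S ->
        translation_invariant mu ->
        mu B = 0%E \/ ~ sigma_finite_for mu B].

Definition liouville (R : realType) : set R :=
  [set x | irrational x /\
    forall n : nat, exists (p : int) (q : nat),
      (2 <= q)%N /\ `|x - p%:~R / q%:R| < 1 / q%:R ^+ n].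

(* Main.v *)
(* Suppose [mu] is translation invariant, the Liouville set [L] is sigma-finite
   for [mu] and [mu L > 0].  Choose a subset [A] of [L], [0 < mu A < oo], contained
   in a closed set [K] on which the denominators [q] of the approximations of
   order [n] are bounded by some [N n].  Then [K] is Lebesgue-null, so by Fubini
   [mu (A `&` (K + s)) = 0] for almost every [s], and since [K] is closed and
   [mu A] finite this holds for a dense G_delta of [s].  On the other hand
   [K + t] consists of Liouville and rational numbers for a dense G_delta of
   [t], namely for [t] having rational approximations good enough in terms of
   [N].  By Baire category and Zorn's lemma there are uncountably many such [t]
   for which the sets [A + t] intersect pairwise in null sets.  They all have
   measure [mu A > 0] and lie in the union of [L] and the rationals, which is
   sigma-finite: this is impossible. *)
From HB Require Import structures.
Require Import Defs.
From mathcomp Require Import all_boot all_order all_algebra.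
From mathcomp Require Import all_classical all_reals all_analysis.
From mathcomp Require Import measurable_realfun borel_hierarchy ring lra zify.

Set Implicit Arguments.
Unset Strict Implicit.
Unset Printing Implicit Defensive.

Import Order.TTheory GRing.Theory Num.Theory.
Import numFieldNormedType.Exports.

Local Open Scope classical_set_scope.
Local Open Scope ring_scope.

(** * Closed sets of points approximated with bounded denominators *)

(** The index [k] stands for the numerator [p = k - M * q]. Restricting to [p / q] of size at most
    [M] makes the union finite, hence closed and accessible to a union bound. *)
Definition strip (R : realType) (n M q : nat) : set R :=
  \big[setU/set0]_(k < (2 * (M * q)).+1)
    closed_ball ((k%:R - (M * q)%:R) / q%:R : R) (q%:R ^- n).
Arguments strip : clear implicits.

(** The shift [q.+2] encodes the condition [2 <= q]: denominators run from 2 to [Q + 1]. *)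
Definition strips (R : realType) (n M Q : nat) : set R :=
  \big[setU/set0]_(q < Q) strip R n M q.+2.
Arguments strips : clear implicits.

Lemma in_strip (R : realType) n M q (x : R) : (0 < q)%N ->
  strip R n M q x <->
  exists p : int, (`|p| <= M * q)%N /\ `|x - p%:~R / q%:R| <= q%:R ^- n.
Proof.
move=> q0; rewrite /strip -(bigcup_mkord _ (fun k : nat =>
  closed_ball ((k%:R - (M * q)%:R) / q%:R : R) (q%:R ^- n))).
have r0 : 0 < (q%:R : R) ^- n by rewrite invr_gt0 exprn_gt0// ltr0n.
split=> [[k /= kM]|[p [pM xp]]].
  rewrite closed_ballE// /closed_ball_/= distrC => xk.
  exists (k%:Z - (M * q)%:Z); split; first by lia.
  by rewrite rmorphB.
exists (absz (p + (M * q)%:Z)); first by rewrite /=; lia.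
rewrite closed_ballE// /closed_ball_/= distrC.
suff -> : ((absz (p + (M * q)%:Z))%:R - (M * q)%:R : R) = p%:~R by [].
rewrite -[X in X - _]/(((absz (p + (M * q)%:Z))%:Z)%:~R) gez0_abs; last by lia.
by rewrite rmorphD/= addrK.
Qed.

Lemma in_strips (R : realType) n M Q (x : R) :
  strips R n M Q x <->
  exists (p : int) (q : nat), [/\ (q < Q)%N, (`|p| <= M * q.+2)%N &
    `|x - p%:~R / q.+2%:R| <= q.+2%:R ^- n].
Proof.
rewrite /strips -(bigcup_mkord _ (fun q => strip R n M q.+2)); split.
  by move=> [q /= qQ] /in_strip[//|p [pM xp]]; exists p, q.
by move=> [p [q [qQ pM xp]]]; exists q => //; apply/in_strip => //; exists p.
Qed.

Lemma closed_strips (R : realType) n M Q : closed (strips R n M Q).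
Proof.
apply: closed_bigsetU => q _; apply: closed_bigsetU => k _.
exact: closed_ball_closed.
Qed.

Lemma subset_strips (R : realType) n M M' Q Q' : (M <= M')%N -> (Q <= Q')%N ->
  strips R n M Q `<=` strips R n M' Q'.
Proof.
move=> MM' QQ' x /in_strips[p [q [qQ pM xp]]]; apply/in_strips; exists p, q.
split=> //; first exact: leq_trans QQ'.
by apply: leq_trans pM _; rewrite leq_mul2r MM' orbT.
Qed.

Lemma sum_inv_sqr_le (R : realType) Q :
  \sum_(q < Q) (q.+2%:R : R) ^- 2 <= 1.
Proof.
(* Telescoping: [1 / (q + 2) ^ 2] is at most [1 / (q + 1) - 1 / (q + 2)]. *)
suff : \sum_(q < Q) (q.+2%:R : R) ^- 2 <= 1 - Q.+1%:R^-1.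
  by move/le_trans; apply; rewrite gerBl invr_ge0.
elim: Q => [|Q IH]; first by rewrite big_ord0 invr1 subrr.
rewrite big_ord_recr/=; apply: (le_trans (lerD IH (lexx _))).
rewrite -addrA lerD2l -lerBrDl opprK addrC -[Q.+2%:R]natr1.
set y : R := Q.+1%:R; have y0 : 0 < y by rewrite ltr0n.
have -> : y^-1 - (y + 1)^-1 = (y * (y + 1))^-1 by field; lra.
rewrite lef_pV2 ?posrE; nra.
Qed.

(** A denominator [q] contributes [2 * M * q + 1] intervals of length [2 * q ^- (n + 3)], in total
    at most [(4 * M + 2) * 2 ^- n * q ^- 2]. Summing [q ^- 2] gives at most 1, so the bound is
    independent of [Q]. *)
Lemma lebesgue_strips_le (R : realType) n M Q :
  (lebesgue_measure (strips R n.+3 M Q) <= ((4 * M + 2)%:R / 2 ^+ n)%:E)%E.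
Proof.
have mstrip q : (lebesgue_measure (strip R n.+3 M q.+2) <=
    ((4 * M + 2)%:R / 2 ^+ n * q.+2%:R ^- 2)%:E)%E.
  pose A k := closed_ball ((k%:R - (M * q.+2)%:R) / q.+2%:R : R) (q.+2%:R ^- n.+3).
  have lA k : lebesgue_measure (A k) = (q.+2%:R ^- n.+3 *+ 2 : R)%:E.
    by rewrite lebesgue_measure_closed_ball// invr_ge0 exprn_ge0.
  apply: (le_trans (@Boole_inequality _ _ _ (@lebesgue_measure R) A _ _)).
    by move=> i _; apply: closed_measurable; exact: closed_ball_closed.
  rewrite (eq_bigr (fun=> (q.+2%:R ^- n.+3 *+ 2 : R)%:E)); last first.
    by move=> i _; exact: lA.
  rewrite sumEFin lee_fin sumr_const card_ord -[leLHS]mulr_natr -[_ *+ 2]mulr_natr.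
  rewrite -[(2 * (M * q.+2)).+1%:R]natr1 !natrM natrD natrM.
  set z : R := q.+2%:R; have z2 : 2 <= z by rewrite ler_nat.
  have M0 : 0 <= M%:R :> R by [].
  have -> : z ^- n.+3 * 2 * (2 * (M%:R * z) + 1) =
      z ^- n * z ^- 2 * (4 * M%:R + 2 / z).
    rewrite -addn3 exprD !exprS expr0 mulr1.
    by field; rewrite expf_neq0 /=; lra.
  rewrite [leRHS](_ : _ = 2 ^- n * z ^- 2 * (4 * M%:R + 2)); last by ring.
  have z0 : 0 < z by lra.
  apply: ler_pM.
  - by rewrite mulr_ge0// invr_ge0 exprn_ge0// ltW.
  - by rewrite addr_ge0 ?mulr_ge0 ?invr_ge0//; lra.
  - rewrite ler_pM2r ?invr_gt0 ?exprn_gt0// lef_pV2 ?posrE ?exprn_gt0//.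
    by apply: lerXn2r; rewrite ?nnegrE//; lra.
  - by rewrite lerD2l ler_pdivrMr//; lra.
apply: (le_trans (@Boole_inequality _ _ _ (@lebesgue_measure R)
  (fun q => strip R n.+3 M q.+2) _ _)).
  move=> i _; apply: closed_measurable.
  by apply: closed_bigsetU => k _; exact: closed_ball_closed.
apply: (le_trans (lee_sum _ (fun (i : 'I_Q) _ => mstrip i))).
rewrite sumEFin lee_fin -mulr_sumr ler_piMr ?sum_inv_sqr_le//.
Qed.

(** * Open dense sets whose intersection is the Liouville numbers and the rationals *)

Definition layer (R : realType) (n : nat) : set R :=
  [set x | exists (p : int) (q : nat),
    (2 <= q)%N /\ `|x - p%:~R / q%:R| < 1 / q%:R ^+ n].
Arguments layer : clear implicits.

Lemma liouvilleE (R : realType) :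
  @liouville R = \bigcap_n layer R n `\` @rational R.
Proof.
apply/seteqP; split=> x [].
  by move=> irr xl; split=> // n _; exact: xl.
by move=> xl irr; split=> // n; exact: xl n I.
Qed.

Lemma open_layer (R : realType) n : open (layer R n).
Proof.
have -> : layer R n = \bigcup_(z in [set z : int * nat | (2 <= z.2)%N])
    ball (z.1%:~R / z.2%:R : R) (1 / z.2%:R ^+ n).
  apply/seteqP; split => x.
    move=> [p [q [q2 xpq]]]; exists (p, q) => //=.
    by rewrite /ball/= distrC.
  by move=> [[p q] /= q2]; rewrite /ball/= distrC => xpq; exists p, q.
by apply: bigcup_open => z _; exact: ball_open.
Qed.

Lemma rational_layer (R : realType) n : @rational R `<=` layer R n.
Proof.
move=> r /rationalP[a [[|b] ->]].
  (* A denominator 0 gives the value 0. Otherwise doubling numerator and denominator ensures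
     [2 <= q]. *)
  exists 0, 2%N; split=> //; rewrite invr0 mulr0 mul0r subrr normr0.
  by rewrite divr_gt0// exprn_gt0.
exists (a *+ 2), (b.+1 * 2)%N; split; first by lia.
rewrite natrM rmorphMn/= -[_ *+ 2]mulr_natr.
by rewrite -mulf_div divff ?mulr1 ?subrr ?normr0 ?pnatr_eq0//.
Qed.

Lemma denseS (T : topologicalType) (A B : set T) :
  A `<=` B -> dense A -> dense B.
Proof.
move=> AB dA U U0 oU; have [x [Ux Ax]] := dA U U0 oU.
by exists x; split=> //; exact: AB.
Qed.

Lemma dense_layer (R : realType) n : dense (layer R n).
Proof. exact: denseS (@rational_layer R n) (@dense_rat R). Qed.

(** One [N] bounds both the denominator and the size of the fraction, so each order has a single
    increasing sequence of closed sets. *)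
Lemma layer_strips (R : realType) n :
  layer R n `<=` \bigcup_N strips R n N N.
Proof.
move=> x [p [[|[|q]] [//_ xp]]]; exists (maxn q.+1 `|p|)%N => //.
apply/in_strips; exists p, q; split; first by rewrite leq_max leqnn.
  by nia.
by move: xp; rewrite div1r; exact: ltW.
Qed.

Lemma lebesgue_bigcap_strips (R : realType) (N : nat -> nat) (K : set R) :
  measurable K -> (forall n, K `<=` strips R n (N n) (N n)) ->
  lebesgue_measure K = 0%E.
Proof.
(* Order 0 places [K] within 1 of fractions of size at most [N 0], and the approximants of any order
   are within 1 of [K]. Their size is thus at most [N 0 + 2], uniformly in the order, and the
   measure bound tends to 0. *)
move=> mK KN; set B := (N 0%N).+2.
have KB n : K `<=` strips R n B (N n).
  move=> x Kx; have /in_strips[p [q [qN pN xp]]] := KN n x Kx.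
  have /in_strips[p' [q' [_ pN' xp']]] := KN 0%N x Kx.
  apply/in_strips; exists p, q; split=> //.
  move: xp'; rewrite expr0 invr1 => xp'.
  have {}xp : `|x - p%:~R / q.+2%:R| <= 1.
    apply: (le_trans xp); rewrite invf_le1 ?exprn_gt0//.
    by rewrite exprn_ege1// ler1n.
  set z : R := q.+2%:R in xp *; set z' : R := q'.+2%:R in xp' *.
  have z0 : 0 < z by rewrite ltr0n.
  have z'0 : 0 < z' by rewrite ltr0n.
  have h' : `|p'%:~R / z'| <= (N 0%N)%:R.
    rewrite normrM normfV (gtr0_norm z'0) ler_pdivrMr// -intr_norm.
    by rewrite -natrM -[leRHS]/(((N 0%N * q'.+2)%N%:Z)%:~R) ler_int; lia.
  have : `|p%:~R / z| <= B%:R.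
    rewrite /B -[(N 0%N).+2]addn2 natrD.
    move: h' xp xp'; set u := p'%:~R / _; set v := p%:~R / _.
    rewrite !ler_norml; lra.
  rewrite normrM normfV (gtr0_norm z0) ler_pdivrMr// -intr_norm.
  by rewrite -natrM -[leRHS]/(((B * q.+2)%N%:Z)%:~R) ler_int; lia.
have le n : (lebesgue_measure K <= ((4 * B + 2)%:R / 2 ^+ n)%:E)%E.
  apply: le_trans (lebesgue_strips_le R n B (N n.+3)).
  apply: le_measure; last exact: KB.
    by rewrite inE.
  rewrite inE.
  exact: closed_measurable (@closed_strips R _ _ _).
have Kfin : lebesgue_measure K \is a fin_num.
  by rewrite ge0_fin_numE//; apply: le_lt_trans (le 0%N) (ltry _).
rewrite -(fineK Kfin); congr _%:E; apply/eqP; rewrite eq_le fine_ge0// andbT.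
rewrite leNgt; apply/negP => a0.
move: le; rewrite -(fineK Kfin); set a := fine _ in a0 * => le.
set c : R := (4 * B + 2)%:R in le.
have := le (Num.bound (c / a)); rewrite lee_fin ler_pdivlMr ?exprn_gt0//.
apply/negP; rewrite -ltNge mulrC -ltr_pdivrMr//.
exact: upper_nthrootP.
Qed.

(** Baire category, applied to the layers and to open dense sets whose intersection is the
    irrationals. *)
Lemma liouville_nonempty (R : realType) : @liouville R !=set0.
Proof.
have [F oF irrE] := @irrational_Gdelta R.
have : dense (\bigcap_n (layer R n `&` F n)).
  apply: Baire => n; have [? ?] := oF n.
  split; first by apply: openI => //; exact: open_layer.
  by apply: denseI => //; [exact: open_layer|exact: dense_layer].
move=> /(_ setT (ex_intro _ 0 I) openT) [x [_ xF]].
exists x; rewrite liouvilleE; split; first by move=> n _; exact: (xF n I).1.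
suff : irrational x by [].
by rewrite irrE => n _; exact: (xF n I).2.
Qed.

Lemma borel_liouville (R : realType) : borel (@liouville R).
Proof.
have oB (A : set R) : open A -> borel A by exact: sub_sigma_algebra.
have [B0 BC BU] : sigma_algebra setT (@borel R) by exact: smallest_sigma_algebra.
have BI (F : (set R)^nat) : (forall n, borel (F n)) -> borel (\bigcap_n F n).
  move=> BF; rewrite -[X in borel X]setCK setC_bigcap -setTD.
  by apply: (BC); apply: BU => n; rewrite -setTD; exact: BC.
have [F oF irrE] := @irrational_Gdelta R.
have -> : @liouville R = \bigcap_n (layer R n `&` F n).
  rewrite liouvilleE bigcapI -irrE.
  by apply/seteqP; split => x [].
by apply: BI => n; apply: oB; apply: openI; [exact: open_layer|exact: (oF n).1].
Qed.

(* If [x] is within [q ^- expo m d] of [p / q] and [t] is sufficiently close to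
   [a / d], then [x + t] is within [(q * d) ^- m] of a fraction of denominator
   [q * d]; how close [t] has to be depends on [x] only through a bound on [q]. *)
Definition expo (m d : nat) : nat := (m + m * d).+1.

Definition shifts (R : realType) (N : nat -> nat) (m : nat) : set R :=
  \bigcup_(z in [set z : int * nat | (0 < z.2)%N])
    ball (z.1%:~R / z.2%:R : R)
      (1 / (2 * ((N (expo m z.2)).+1 * z.2)%:R ^+ m)).
Arguments shifts : clear implicits.

Lemma open_shifts (R : realType) N m : open (shifts R N m).
Proof. by apply: bigcup_open => z _; exact: ball_open. Qed.

Lemma dense_shifts (R : realType) N m : dense (shifts R N m).
Proof.
apply: denseS (@dense_rat R) => r /rationalP[a [[|b] ->]].
  exists (0, 1%N) => //=; rewrite invr0 mulr0 mul0r; apply: ballxx.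
  by rewrite divr_gt0// mulr_gt0// exprn_gt0.
exists (a, b.+1) => //=; apply: ballxx.
by rewrite divr_gt0// mulr_gt0// exprn_gt0// ltr0n muln_gt0.
Qed.

(** The summands 1, [m] and [m * d] of the exponent absorb the factors 2, [q ^ m] and [d ^ m], the
    last since [d < q ^ d]. *)
Lemma expo_le (q d m : nat) : (2 <= q)%N ->
  (2 * (q * d) ^ m <= q ^ expo m d)%N.
Proof.
move=> q2; rewrite /expo expnS expnD expnMn (mulnC m) expnM.
rewrite leq_mul// leq_mul//; case: m => // m.
by rewrite leq_exp2r// ltnW// ltn_expl.
Qed.

(** The order [expo m d] is chosen once [t] has provided [d]. The errors of [x] and of [t] then each
    take at most half of [(q * d) ^- m]. *)
Lemma shift_layer (R : realType) N m (x t : R) :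
  (forall n, strips R n (N n) (N n) x) -> shifts R N m t -> layer R m (x + t).
Proof.
move=> xN [[a d] /= d0]; rewrite /ball/= distrC => td.
have /in_strips[p [q [qN _ xpq]]] := xN (expo m d).
exists (p * d%:Z + a * q.+2%:Z), (q.+2 * d)%N; split; first by nia.
set e := expo m d in td qN xpq; set z : R := q.+2%:R in xpq.
have z0 : 0 < z by rewrite ltr0n.
have D0 : 0 < d%:R :> R by rewrite ltr0n.
rewrite natrM rmorphD !rmorphM/= -!pmulrn -/z.
have -> : x + t - (p%:~R * d%:R + a%:~R * z) / (z * d%:R) =
    (x - p%:~R / z) + (t - a%:~R / d%:R) by field; lra.
apply: (le_lt_trans (ler_normD _ _)).
have -> : 1 / (z * d%:R) ^+ m =
   1 / (2 * (z * d%:R) ^+ m) + 1 / (2 * (z * d%:R) ^+ m).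
  by field; rewrite expf_neq0//; apply: lt0r_neq0; exact: mulr_gt0.
have P0 : 0 < 2 * (z * d%:R) ^+ m by rewrite mulr_gt0// exprn_gt0// mulr_gt0.
apply: ler_ltD.
  apply: (le_trans xpq); rewrite div1r lef_pV2 ?posrE ?exprn_gt0//.
  by rewrite /z -natrM -!natrX -natrM ler_nat; exact: expo_le.
apply: (lt_le_trans td); rewrite !div1r lef_pV2 ?posrE//; last first.
  by rewrite mulr_gt0// exprn_gt0// ltr0n muln_gt0.
rewrite ler_pM2l// lerXn2r ?nnegrE//; first by rewrite mulr_ge0 ?ltW.
(* The denominator [q.+2] is at most [(N e).+1], the value built into the radius in [shifts]. *)
by rewrite /z -natrM ler_nat leq_mul2r ltnS qN orbT.
Qed.

(** * Translates of a closed Lebesgue-null set under a finite measure *)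

Lemma translateE (R : realType) (A : set R) (t : R) :
  translate A t = [set x | A (x - t)].
Proof.
apply/seteqP; split=> [_ [x Ax <-]|x Ax] /=; first by rewrite addrK.
by exists (x - t) => //; rewrite subrK.
Qed.

Lemma lebesgue_measure_reflect (R : realType) (A : set R) (a : R) :
  measurable A ->
  lebesgue_measure [set s | A (a - s)] = lebesgue_measure A.
Proof.
move=> mA.
have mf : measurable_fun setT (fun s : R => a - s).
  by apply: measurable_funB => //.
suff : lebesgue_measure A =
    pushforward lebesgue_measure ((fun s => a - s) : R -> measurableTypeR R) A by [].
apply: lebesgue_measure_unique => //= _ [[u v]] _ <-.
rewrite /pushforward/=.
rewrite (_ : _ @^-1` _ = `[a - v, a - u[%classic).
  rewrite !lebesgue_measure_itv/= !lte_fin ltrD2l ltrN2.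
  by case: ifP => // _; congr _%:E; ring.
by apply/seteqP; split=> s /=; rewrite !in_itv/= => /andP[? ?]; apply/andP; split; lra.
Qed.

(* Fubini: the average over [s] of [nu (K + s)] is the [nu]-integral of the
   Lebesgue measure of [x - K]. *)
Lemma dense_null_translates (R : realType) (nu : {finite_measure set R -> \bar R})
    (K : set R) :
  measurable K -> lebesgue_measure K = 0%E ->
  dense [set s | nu (translate K s) = 0%E].
Proof.
move=> mK K0.
pose X := [set z : measurableTypeR R * R | K (z.2 - z.1)].
have mX : measurable X.
  rewrite -[X]setTI.
  apply: (_ : measurable_fun setT (fun z : R * R => z.2 - z.1)) => //.
  by apply: measurable_funB.
have eqX : ((@lebesgue_measure R) \x nu)%E X = ((@lebesgue_measure R) \x^ nu)%E X.
  apply: product_measure_unique => // A B mA mB.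
  exact: (product_measure2E (@lebesgue_measure R) nu mA mB).
have X0 : ((@lebesgue_measure R) \x nu)%E X = 0%E.
  rewrite eqX /product_measure2; apply: integral0_eq => x _ /=.
  rewrite (_ : ysection _ _ = [set s | K (x - s)]) ?lebesgue_measure_reflect//.
  by rewrite ysectionE.
have secX s : xsection X s = translate K s by rewrite translateE xsectionE.
have mXnu : measurable_fun setT (nu \o xsection X).
  exact: measurable_fun_xsection.
move: X0; rewrite /product_measure1.
under eq_integral => s _ do rewrite -[_ s]gee0_abs//.
move=> /ae_eq_integral_abs => /(_ measurableT mXnu) ae0.
move=> U [u Uu] oU.
have /nbhs_ballP[e /= e0 eU] : nbhs u U by exact: open_nbhs_nbhs.
have [N [mN N0 subN]] := (ae0).
(* Otherwise a ball of positive radius would lie in the Lebesgue-null exceptional set. *)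
apply: contrapT => noU.
have : (lebesgue_measure (ball u e) <= lebesgue_measure N)%E.
  apply: le_measure; rewrite ?inE//.
    exact: measurable_ball.
  move=> s /eU Us; apply: subN => /= /(_ I) /= s0.
  by apply: noU; exists s; split=> //=; rewrite -secX.
apply/negP; rewrite N0 lebesgue_measure_ball; last exact: ltW.
by rewrite -ltNge lte_fin pmulrn_lgt0.
Qed.

Lemma measurable_translate (R : realType) (K : set R) (s : R) :
  measurable K -> measurable (translate K s).
Proof.
move=> mK; rewrite translateE -[X in measurable X]setTI.
suff : measurable_fun setT (fun x : R => x - s) by apply.
exact: measurable_funB.
Qed.

(** The open neighbourhoods [F n] of [K + s] decrease to [K + s] because [K] is closed, so their
    [nu]-measures converge to that of [K + s]. Every [t] close to [s] keeps [K + t] inside a given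
    [F N]. *)
Lemma open_small_translates (R : realType)
    (nu : {finite_measure set R -> \bar R}) (K : set R) (e : \bar R) :
  closed K -> open [set s | (nu (translate K s) < e)%E].
Proof.
move=> cK; rewrite openE => s /= se.
pose F n := \bigcup_(k in K) ball (k + s) (n.+1%:R^-1 : R).
have oF n : open (F n) by apply: bigcup_open => k _; exact: ball_open.
have mF n : measurable (F n) by exact: open_measurable.
have capF : \bigcap_n F n = translate K s.
  rewrite translateE; apply/seteqP; split=> x /= Fx; last first.
    move=> n _; exists (x - s) => //; rewrite subrK.
    by apply: ballxx; rewrite invr_gt0.
  apply: cK => B /nbhs_ballP[r /= r0 rB].
  have [n nr] : exists n, (n.+1%:R^-1 : R) < r.
    exists (Num.bound r^-1); rewrite invf_plt ?posrE//.
    apply: (lt_trans (archi_boundP _)); first by rewrite invr_ge0 ltW.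
    by rewrite ltr_nat.
  have [k Kk xk] := Fx n I; exists k; split => //; apply: rB.
  move: xk; rewrite /ball/= => xk; apply: lt_trans nr.
  by rewrite distrC; apply: le_lt_trans xk; rewrite opprB addrA.
have : (nu (F n) @[n --> \oo] --> nu (translate K s))%E.
  rewrite -capF; apply: nonincreasing_cvg_mu => //.
  - by rewrite -ge0_fin_numE//; exact: fin_num_measure.
  - by rewrite capF; apply: measurable_translate; exact: closed_measurable.
  - move=> n m nm; apply/subsetPset => x [k Kk xk]; exists k => //.
    by apply: le_ball xk; rewrite lef_pV2 ?posrE// ler_nat.
have oe : open [set z : \bar R | (z < e)%E] by exact: open_ereal_lt_ereal.
move=> /(_ [set z | (z < e)%E]) /= [|N _ NF].
  by apply: open_nbhs_nbhs; split.
have {}NF : (nu (F N) < e)%E by apply: NF => /=.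
apply/nbhs_ballP; exists N.+1%:R^-1 => /=; first by rewrite invr_gt0.
move=> t st /=; apply: le_lt_trans NF; apply: le_measure; rewrite ?inE//.
  by apply: measurable_translate; exact: closed_measurable.
move=> _ [k Kk <-]; exists k => //.
by move: st; rewrite /ball/= opprD addrACA subrr add0r.
Qed.

Lemma null_translates_Gdelta_dense (R : realType)
    (nu : {finite_measure set R -> \bar R}) (K : set R) :
  closed K -> lebesgue_measure K = 0%E ->
  Gdelta_dense [set s | nu (translate K s) = 0%E].
Proof.
move=> cK K0; have mK : measurable K by exact: closed_measurable.
exists (fun n => [set s | (nu (translate K s) < n.+1%:R^-1%:E)%E]) => [n|].
  split; first exact: open_small_translates.
  apply: denseS (dense_null_translates nu mK K0) => s /= ->.
  by rewrite lte_fin invr_gt0.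
apply/seteqP; split=> [s /= s0 n _|s /= sn] /=.
  by rewrite s0 lte_fin invr_gt0.
have fin : nu (translate K s) \is a fin_num.
  by apply: fin_num_measure; exact: measurable_translate.
apply/eqP; rewrite eq_le measure_ge0 andbT; apply/lee_addgt0Pr => e e0.
rewrite add0e; apply/ltW; apply: lt_trans (sn (Num.bound e^-1) I) _.
rewrite lte_fin invf_plt ?posrE//.
apply: (lt_trans (archi_boundP _)); first by rewrite invr_ge0 ltW.
by rewrite ltr_nat.
Qed.

(** * Dense G_delta sets and Baire category *)

Lemma Gdelta_denseI (T : topologicalType) (A B : set T) :
  Gdelta_dense A -> Gdelta_dense B -> Gdelta_dense (A `&` B).
Proof.
move=> [F oF ->] [G oG ->]; exists (fun n => F n `&` G n); last by rewrite bigcapI.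
move=> n; have [? ?] := oF n; have [? ?] := oG n.
by split; [exact: openI|exact: denseI].
Qed.

Lemma Gdelta_dense_bigcap (T : topologicalType) (F : nat -> set T) :
  (forall n, Gdelta_dense (F n)) -> Gdelta_dense (\bigcap_n F n).
Proof.
move=> GF; have /choice[A AF] n : exists A : nat -> set T,
    (forall i, open (A i) /\ dense (A i)) /\ F n = \bigcap_i A i.
  by have [A ? ?] := GF n; exists A.
(* A code of no pair contributes the whole space, which is open and dense. *)
exists (fun k => if unpickle k is Some (n, i) then A n i else setT).
  move=> k; case: unpickle => [[n i]|]; first exact: (AF n).1.
  by split; [exact: openT|move=> U [u Uu] _; exists u].
apply/seteqP; split=> x Fx.
  move=> k _; case: unpickle => [[n i]|//].
  by have := Fx n I; rewrite (AF n).2; apply.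
move=> n _; rewrite (AF n).2 => i _.
by have := Fx (pickle (n, i)) I; rewrite pickleK.
Qed.

Lemma Gdelta_dense_preimage (T : topologicalType) (f g : T -> T) (A : set T) :
  cancel f g -> cancel g f -> continuous f -> continuous g ->
  Gdelta_dense A -> Gdelta_dense (f @^-1` A).
Proof.
move=> fK gK cf cg [F oF ->]; exists (fun n => f @^-1` F n); last first.
  by rewrite preimage_bigcap.
move=> n; have [oFn dFn] := oF n; split; first by move/continuousP : cf; apply.
move=> U [u Uu] oU.
have gU0 : g @^-1` U !=set0 by exists (f u); rewrite /= fK.
have ogU : open (g @^-1` U) by move/continuousP : cg; apply.
have [x [/= Ux Fx]] := dFn _ gU0 ogU.
by exists (g x); split => //=; rewrite gK.
Qed.

Lemma Gdelta_dense_set1C (R : realType) (t : R) : Gdelta_dense [set~ t].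
Proof.
exists (fun=> [set~ t]) => [_|]; last by rewrite bigcap_const//; exists 0%N.
split; last exact: dense_set1C.
by rewrite openC; exact/accessible_closed_set1/hausdorff_accessible/Rhausdorff.
Qed.

Lemma Gdelta_dense_nonempty (R : realType) (A : set R) : Gdelta_dense A -> A !=set0.
Proof.
move=> [F oF ->].
have /(_ setT (ex_intro _ 0 I) openT)[x [_ Fx]] := Baire oF.
by exists x.
Qed.

(* A maximal set of pairwise differences in [G] cannot be countable: by Baire
   category it could be extended. *)
Lemma uncountable_clique (R : realType) (A G : set R) :
  Gdelta_dense A -> Gdelta_dense G ->
  exists T : set R, [/\ ~ countable T, T `<=` A &
    forall s t, T s -> T t -> s != t -> G (t - s)].
Proof.
move=> dA dG.
pose P (T : set R) := T `<=` A /\ forall s t, T s -> T t -> s != t -> G (t - s).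
have [|T [[TA TG] Tmax]] := @Zorn_bigcup R P.
  move=> F FP Ftot; split=> [x [X FX Xx]|s t [X FX Xs] [Y FY Yt] st].
    exact: (FP _ FX).1.
  have [XY|YX] := Ftot X Y FX FY.
  - by apply: (FP _ FY).2 => //; exact: XY.
  - by apply: (FP _ FX).2 => //; exact: YX.
exists T; split=> // cT.
have cB (t : R) : continuous (fun x : R => x - t).
  by move=> x; apply: cvgB; [exact: cvg_id|exact: cvg_cst].
have cD (t : R) : continuous (fun x : R => x + t).
  by move=> x; apply: cvgD; [exact: cvg_id|exact: cvg_cst].
have cN (t : R) : continuous (fun x : R => t - x).
  by move=> x; apply: cvgB; [exact: cvg_cst|exact: cvg_id].
(* [D t] consists of the points that can join a clique containing [t]; both signs of the difference
   occur because the condition is on ordered pairs. *)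
pose D t := [set~ t] `&` ([set x | G (x - t)] `&` [set x | G (t - x)]).
have dD t : Gdelta_dense (D t).
  apply: Gdelta_denseI; first exact: Gdelta_dense_set1C.
  apply: Gdelta_denseI.
    apply: (@Gdelta_dense_preimage _ (fun x => x - t) (fun x => x + t)) => //.
      by move=> x; rewrite subrK.
    by move=> x; rewrite addrK.
  by apply: (@Gdelta_dense_preimage _ (fun x => t - x) (fun x => t - x)) => // x;
    rewrite opprB addrC subrK.
have [h Th] : exists h : nat -> R, T `<=` range h.
  have [->|[h]] := pfcard_geP cT; first by exists (fun=> 0).
  by exists h => t /(@surj _ _ _ _ h).
have /Gdelta_dense_nonempty[x [Ax Dx]] : Gdelta_dense (A `&` \bigcap_n D (h n)).
  by apply: Gdelta_denseI => //; exact: Gdelta_dense_bigcap.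
have {}Dx t : T t -> D t x by move=> /Th[n _ <-]; exact: Dx.
apply: (Tmax (T `|` [set x])).
  split=> [|xT]; first exact: subsetUl.
  have Tx : T x by apply: xT; right.
  have [xx _] := Dx x Tx.
  exact: xx erefl.
split; first by move=> y [/TA//|->].
move=> s t [Ts|->] [Tt|->].
- exact: TG.
- by move=> _; have [_ []] := Dx s Ts.
- by move=> _; have [_ []] := Dx t Tt.
- by rewrite eqxx.
Qed.

(** * Families of sets with null pairwise intersections, and exhaustion in measure *)

Lemma measure_bigsetU_ae_disjoint d (X : measurableType d) (R : realType)
    (mu : {measure set X -> \bar R}) (I : eqType) (s : seq I) (A : I -> set X) :
  uniq s -> (forall t, t \in s -> measurable (A t)) ->
  (forall t u, t \in s -> u \in s -> t != u -> mu (A t `&` A u) = 0%E) ->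
  (mu (\big[setU/set0]_(t <- s) A t) = \sum_(t <- s) mu (A t))%E.
Proof.
elim: s => [|t s IH]; first by rewrite !big_nil measure0.
rewrite [uniq _]/= => /andP[ts us] mA A0; rewrite !big_cons.
have s_ts u : u \in s -> u \in t :: s by rewrite inE => ->; rewrite orbT.
have t_ts : t \in t :: s by rewrite inE eqxx.
rewrite -IH//; last 2 first.
- by move=> u /s_ts; exact: mA.
- by move=> u v /s_ts us' /s_ts vs'; exact: A0.
set U := \big[setU/set0]_(u <- s) A u.
have [mU AU0] : measurable U /\ mu (A t `&` U) = 0%E.
  rewrite /U big_seq; apply: (big_ind (fun V => measurable V /\ mu (A t `&` V) = 0%E)).
  - by rewrite setI0 measure0.
  - move=> V W [mV V0] [mW W0]; split; first exact: measurableU.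
    by rewrite setIUr null_set_setU//; apply: measurableI => //; exact: mA.
  - move=> u us'; split; first by apply: mA; exact: s_ts.
    apply: A0 => //; first exact: s_ts.
    by apply: contraNneq ts => ->.
have mAt := mA t t_ts.
have -> : A t `|` U = (A t `\` U) `|` U.
  by apply/seteqP; split => x; have [?|?] := pselect (U x); rewrite /setU/setD/=; tauto.
rewrite measureU//; [|exact: measurableD|by rewrite setDE -setIA setICl setI0].
have -> : (mu (A t) = mu (A t `\` U) + mu (A t `&` U))%E by exact: measureDI.
by rewrite AU0 adde0.
Qed.

(** Each [A t] meets some [F n] in measure at least some [1 / (k + 1)]. For fixed [n] and [k] only
    finitely many [t] do so, since their traces on [F n] have additive measure, bounded by that of
    [F n]. *)
Lemma countable_ae_disjoint d (X : measurableType d) (R : realType)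
    (mu : {measure set X -> \bar R}) (I : choiceType) (T : set I)
    (A : I -> set X) (F : nat -> set X) :
  (forall n, measurable (F n) /\ (mu (F n) < +oo)%E) ->
  (forall t, T t -> [/\ measurable (A t), A t `<=` \bigcup_n F n & mu (A t) != 0%E]) ->
  (forall s t, T s -> T t -> s != t -> mu (A s `&` A t) = 0%E) ->
  countable T.
Proof.
move=> mF AT A0.
pose c k : R := k.+1%:R^-1.
have c0 k : 0 < c k by rewrite invr_gt0.
pose TT n k := [set t | T t /\ ((c k)%:E <= mu (A t `&` F n))%E].
have finTT n k : finite_set (TT n k).
  have [mFn Fn] := mF n.
  apply: contrapT => /(infinite_set_fset (Num.bound (fine (mu (F n)) / c k)))[B BT Bn].
  set b := finmap.enum_fset B in Bn; have ub : uniq b by exact: finmap.fset_uniq.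
  have BTT t : t \in b -> TT n k t by move=> tB; exact: BT.
  have mAF t : T t -> measurable (A t `&` F n).
    by move=> /AT[? _ _]; exact: measurableI.
  have : (mu (\big[setU/set0]_(t <- b) (A t `&` F n)) <= mu (F n))%E.
    apply: le_measure; rewrite ?inE//; last first.
      elim/big_ind: _ => [//|V W VF WF|t _]; last exact: subIsetr.
      by rewrite subUset.
    rewrite big_seq; apply: bigsetU_measurable => t /BTT[Tt _]; exact: mAF.
  rewrite measure_bigsetU_ae_disjoint //; last 2 first.
  - by move=> t /BTT[Tt _]; exact: mAF.
  - move=> t u /BTT[Tt _] /BTT[Tu _] tu.
    apply: (@subset_measure0 _ _ _ mu _ (A t `&` A u)); last exact: A0.
    + by apply: measurableI; exact: mAF.
    + by have [? _ _] := AT t Tt; have [? _ _] := AT u Tu; exact: measurableI.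
    + by move=> x [[? ?] [? ?]].
  apply/negP; rewrite -ltNge.
  have Ffin : mu (F n) \is a fin_num by rewrite ge0_fin_numE.
  apply: (@lt_le_trans _ _ (\sum_(t <- b) (c k)%:E)%E); last first.
    by rewrite big_seq [leRHS]big_seq; apply: lee_sum => t /BTT[].
  rewrite sumEFin big_const_seq count_predT iter_addr_0 -(fineK Ffin) lte_fin.
  rewrite -mulr_natr mulrC -ltr_pdivrMr//.
  apply: (lt_le_trans (archi_boundP _)); last by rewrite ler_nat.
  by rewrite divr_ge0 ?fine_ge0// ltW.
apply: (@sub_countable _ _ _ (\bigcup_n \bigcup_k TT n k)); last first.
  apply: bigcup_countable => // n _; apply: bigcup_countable => // k _.
  exact: finite_set_countable.
apply: subset_card_le => t Tt; have [mAt AF At0] := AT t Tt.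
apply: contrapT => nTT; move/eqP: At0; apply.
have -> : A t = \bigcup_n (A t `&` F n).
  by rewrite -setI_bigcupr; apply/esym/setIidPl.
have mAF n : measurable (A t `&` F n) by apply: measurableI => //; exact: (mF n).1.
apply/negligibleP; first exact: bigcup_measurable.
apply: negligible_bigcup => n; apply/negligibleP => //.
apply/eqP; rewrite eq_le measure_ge0 andbT; apply/lee_addgt0Pr => e e0.
rewrite add0e leNgt; apply/negP => eA; apply: nTT.
exists n => //; exists (Num.bound e^-1) => //; split=> //.
apply: le_trans (ltW eA); rewrite lee_fin invf_ple ?posrE//.
apply: ltW; apply: (lt_trans (archi_boundP _)); first by rewrite invr_ge0 ltW.
by rewrite ltr_nat.
Qed.

(** Continuity from above gives [N n] for which passing to [C n (N n)] loses less than
    [a / 2 ^ (n + 2)] of the measure [a] of [A]. The total loss is at most [a / 2]. *)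
Lemma exists_bigcap_measure_neq0 d (X : measurableType d) (R : realType)
    (mu : {measure set X -> \bar R}) (A : set X) (C : nat -> nat -> set X) :
  measurable A -> (mu A < +oo)%E -> mu A != 0%E ->
  (forall n k, measurable (C n k)) ->
  (forall n k l, (k <= l)%N -> C n k `<=` C n l) ->
  (forall n, A `<=` \bigcup_k C n k) ->
  exists N : nat -> nat, mu (A `&` \bigcap_n C n (N n)) != 0%E.
Proof.
move=> mA Aoo A0 mC Cle AC.
have Afin : mu A \is a fin_num by rewrite ge0_fin_numE.
pose a := fine (mu A).
have a0 : 0 < a.
  by rewrite lt_neqAle fine_ge0// andbT eq_sym -eqe fineK.
have mAC n k : measurable (A `\` C n k) by exact: measurableD.
have /choice[N AN] n : exists k, (mu (A `\` C n k) < (a / 2 / (2 ^ n.+1)%:R)%:E)%E.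
  have capAC : \bigcap_k (A `\` C n k) = set0.
    rewrite -subset0 => x ACx; have [Ax _] := ACx 0%N I.
    by have [k _ Cx] := AC n x Ax; have [_] := ACx k I.
  have : mu (A `\` C n k) @[k --> \oo] --> mu (\bigcap_k (A `\` C n k)).
    apply: nonincreasing_cvg_mu => //.
    - by apply: le_lt_trans Aoo; apply: le_measure; rewrite ?inE.
    - by rewrite capAC.
    - by move=> k l kl; apply/subsetPset => x [Ax nC]; split=> // /(Cle n k l kl).
  rewrite capAC measure0 => cv0.
  pose e : \bar R := (a / 2 / (2 ^ n.+1)%:R)%:E.
  have e0 : (0 < e)%E by rewrite lte_fin !divr_gt0// ltr0n expn_gt0.
  have oe : open [set z : \bar R | (z < e)%E] by exact: open_ereal_lt_ereal.
  have [k _ /(_ k (leqnn k))] := cv0 _ (open_nbhs_nbhs (conj oe e0)).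
  by exists k.
exists N; set K := \bigcap_n _.
have mK : measurable K by exact: bigcapT_measurable.
apply/eqP => AK0.
have : (mu (A `\` K) <= (a / 2)%:E)%E.
  apply: le_trans (epsilon_trick0 xpredT _); last by rewrite divr_ge0// ltW.
  apply: (@le_trans _ _ (\sum_(0 <= n <oo) mu (A `\` C n (N n)))%E); last first.
    apply: lee_nneseries => [n _ _|n _]; first exact: measure_ge0.
    exact: ltW (AN n).
  apply: measure_sigma_subadditive => //; first exact: measurableD.
  move=> x [Ax]; apply: contra_notP => nx n _.
  by apply: contrapT => nC; apply: nx; exists n.
have -> : (mu (A `\` K) = mu A)%E.
  have -> : (mu A = mu (A `\` K) + mu (A `&` K))%E by exact: measureDI.
  by rewrite AK0 adde0.
by rewrite -(fineK Afin) lee_fin -/a; apply/negP; rewrite -ltNge; lra.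
Qed.

(** This carries the restriction of [mu] to [A] over to the canonical Borel structure of [R], where
    Lebesgue measure and Fubini are available. It is a pushforward along the identity. *)
Lemma trace_finite_measure (R : realType) (S : set (set R))
    (mu : measure_on R S) (A : set R) :
  sigma_algebra setT S -> @borel R `<=` S -> S A -> (mu A < +oo)%E ->
  exists nu : {finite_measure set R -> \bar R},
    forall B, measurable B -> nu B = mu (A `&` B).
Proof.
move=> sS bS SA Aoo.
have SE : S.-sigma.-measurable = S by exact: measurable_g_measurableTypeE.
have mA : S.-sigma.-measurable A by rewrite SE.
have mS (B : set R) : measurable B -> S.-sigma.-measurable B.
  rewrite SE => mB; apply: bS.
  move: B mB; rewrite -[measurable]/((@ocitv R).-sigma.-measurable).
  rewrite RGenOpens.measurableE; apply: smallest_sub.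
    exact: smallest_sigma_algebra.
  by move=> _ [x [y ->]]; apply: sub_sigma_algebra; exact: interval_open.
have mid : measurable_fun setT (idfun : g_sigma_algebraType S -> R).
  by move=> _ B mB; rewrite setTI; exact: mS.
pose push : {measure set R -> \bar R} :=
  pushforward (mrestr mu mA) (idfun : g_sigma_algebraType S -> R).
pose nu0 := push mid.
have nu0fin : fin_num_fun nu0.
  move=> B mB; rewrite ge0_fin_numE// /nu0 /push /= /pushforward /mrestr.
  apply: le_lt_trans Aoo; apply: le_measure; rewrite ?inE//.
  by apply: measurableI => //; exact: mS.
pose H := Measure_isFinite.Build _ _ _ nu0 nu0fin.
pose nu := HB.pack_for {finite_measure set R -> \bar R} (Measure.sort nu0) H.
by exists nu => B mB; rewrite /nu/= /nu0 /push /= /pushforward /mrestr setIC.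
Qed.

(** * Conclusion for the Liouville set *)

Lemma liouville_null (R : realType) (S : set (set R)) (mu : measure_on R S) :
  sigma_algebra setT S -> @borel R `<=` S -> translation_invariant mu ->
  sigma_finite_for mu (@liouville R) -> mu (@liouville R) = 0%E.
Proof.
move=> sS bS inv [F LF Foo].
have SE : S.-sigma.-measurable = S by exact: measurable_g_measurableTypeE.
have bor (C : set R) : closed C -> S C.
  move=> cC; apply: bS; rewrite -[C]setCK -setTD.
  have [_ BC _] : sigma_algebra setT (@borel R) by exact: smallest_sigma_algebra.
  by apply: BC; apply: sub_sigma_algebra; exact: closed_openC.
apply: contrapT => muL.
have [i Fi0] : exists i, mu (F i) != 0%E.
  apply: contrapT => /forallNP F0; apply: muL.
  have mL : S.-sigma.-measurable (@liouville R).
    by rewrite SE; exact: bS _ (@borel_liouville R).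
  apply/(@negligibleP _ (g_sigma_algebraType S) R mu) => //.
  rewrite LF; apply: negligible_bigcup => n.
  by apply/negligibleP; [exact: (Foo n).1|apply/eqP; apply: contrapT => /negP; exact: F0].
have [mFi Fioo] := Foo i.
have Filayer n : F i `<=` layer R n.
  move=> x Fx; have : liouville x by rewrite LF; exists i.
  by rewrite liouvilleE => -[xl _]; exact: xl.
have [|n k l kl||N] := @exists_bigcap_measure_neq0 _ (g_sigma_algebraType S) R mu
    (F i) (fun n k => strips R n k k) mFi Fioo Fi0.
- by move=> n k; rewrite SE; apply: bor; exact: closed_strips.
- exact: subset_strips.
- by move=> n x /(Filayer n); exact: layer_strips.
set K : set R := \bigcap_n _ => A0.
set A : set R := F i `&` K in A0.
have cK : closed K by apply: closed_bigI => n _; exact: closed_strips.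
have KN n : K `<=` strips R n (N n) (N n) by apply: bigcap_inf.
have K0 := lebesgue_bigcap_strips (closed_measurable cK) KN.
have mA : S.-sigma.-measurable A.
  by apply: measurableI => //; rewrite SE; exact: bor.
have SA : S A by rewrite -SE.
have Aoo : (mu A < +oo)%E.
  by apply: le_lt_trans Fioo; apply: le_measure; rewrite ?inE//; exact: subIsetl.
have [nu nuE] := trace_finite_measure sS bS SA Aoo.
have dG := null_translates_Gdelta_dense nu cK K0.
have dW : Gdelta_dense (\bigcap_m shifts R N m).
  exists (shifts R N) => // m.
  by split; [exact: open_shifts|exact: dense_shifts].
have [T [cT TW TG]] := uncountable_clique dW dG.
apply: cT.
(* A point of [A] has finite measure, hence by invariance every singleton has. This allows the
   rationals to be added to the sigma-finite cover. *)
have [a Aa] : A !=set0 by apply/set0P; apply: contraNneq A0 => ->; rewrite measure0.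
have Sa : S [set a].
  by apply: bor; exact/accessible_closed_set1/hausdorff_accessible/Rhausdorff.
have mq (q : R) : S [set q] /\ (mu [set q] < +oo)%E.
  have [] := inv [set a] (q - a) Sa.
  rewrite /translate image_set1 addrC subrK => Sq ->; split=> //.
  apply: le_lt_trans Aoo; apply: le_measure; rewrite ?inE ?SE//.
  by move=> _ ->.
pose Q n : R := if unpickle n is Some q then ratr q else 0.
apply: (@countable_ae_disjoint _ (g_sigma_algebraType S) R mu R T (translate A)
  (fun n => F n `|` [set Q n])).
- move=> n; have [mFn Fnoo] := Foo n; have [SQ Qoo] := mq (Q n).
  have mQ : S.-sigma.-measurable [set Q n] by rewrite SE.
  split; first exact: measurableU.
  by apply: le_lt_trans (measureU2 mu mFn mQ) _; exact: lte_add_pinfty.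
- move=> t Tt; have [SAt At] := inv A t SA.
  split; [by rewrite SE| |by rewrite At].
  move=> _ [x [_ Kx] <-].
  (* The point [x + t] lies in every layer, so it is Liouville unless it is rational. *)
  have xtl : (\bigcap_m layer R m) (x + t).
    by move=> m _; apply: (@shift_layer _ N) (TW t Tt m I) => n; exact: KN.
  have [[q _ qx]|xtr] := pselect (rational (x + t)).
    by exists (pickle q) => //; right; rewrite /= /Q pickleK.
  have : liouville (x + t) by rewrite liouvilleE; split.
  by rewrite LF => -[n _ Fn]; exists n => //; left.
- move=> s t Ts Tt st.
  (* The intersection of [A + s] and [A + t] lies in the translate by [s] of the part of [A] in
     [K + (t - s)]. By invariance that translate has measure [nu (K + (t - s))], which vanishes by
     the choice of [T]. *)
  have mKts : measurable (translate K (t - s)).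
    by apply: measurable_translate; exact: closed_measurable.
  have mAK : S.-sigma.-measurable (A `&` translate K (t - s)).
    apply: measurableI => //; rewrite SE.
    have [] := inv K (t - s); [exact: bor|by []].
  have SAK : S (A `&` translate K (t - s)) by rewrite -SE.
  have [SAKs muAKs] := inv _ s SAK.
  apply: (@subset_measure0 _ _ _ mu _ (translate (A `&` translate K (t - s)) s)).
  + by apply: measurableI; rewrite SE; exact: (inv _ _ SA).1.
  + by rewrite SE.
  + move=> _ [[x Ax <-] [y [_ Ky] yx]]; exists x => //; split=> //.
    by exists y => //; rewrite addrA yx addrK.
  + by apply: (eq_trans muAKs); rewrite -nuE//; exact: TG.
Qed.

Theorem theorem1p1 (R : realType) : immeasurable (@liouville R).
Proof.
split; [exact: liouville_nonempty|exact: borel_liouville|].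
move=> S mu sS bS inv.
have [Lfin|] := pselect (sigma_finite_for mu (@liouville R)); last by right.
by left; exact: liouville_null.
Qed.
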